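(* Let $m \geq 3$ and $n \ge 6$ with $n \equiv 0 \pmod 6$. Then: (a) if $m \equiv 0 \pmod 3$, then $\gamma_{r2}(C_{m} \Box C_n) = \frac{m}{3}\, n$; (b) if $m \equiv 1 \pmod 3$, then $\left(\frac{m-1}{3} + \frac{1}{2}\right) n \le \gamma_{r2}(C_{m} \Box C_n) \le \frac{m+2}{3}\, n$; (c) if $m \equiv 2 \pmod 3$, then $\gamma_{r2}(C_{m} \Box C_n) = \frac{m+1}{3}\, n$.
   Context: For a graph $G$, a 2-rainbow dominating function (2RDF) is a function $f$ assigning to each vertex a subset of $\{1,2\}$ such that every vertex $v$ with $f(v)=\emptyset$ satisfies $\bigcup_{u\in N(v)} f(u)=\{1,2\}$, where $N(v)$ is the open neighborhood of $v$. Its weight is $w(f)=\sum_{v\in V(G)}|f(v)|$, and the 2-rainbow domination number $\gamma_{r2}(G)$ is the minimum weight of a 2RDF of $G$. $C_m \Box C_n$ denotes the Cartesian product of the cycles $C_m$ and $C_n$ (vertex set $V(C_m)\times V(C_n)$, two vertices adjacent iff equal in one coordinate and adjacent in the other). *)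

(* Defs.v *)
From mathcomp Require Import all_boot.

Set Implicit Arguments.
Unset Strict Implicit.
Unset Printing Implicit Defensive.

(* A graph is given by its adjacency relation on a finite vertex type; the
   two colours 1 and 2 are the two elements of 'I_2. *)

Definition open_nbhd (V : finType) (e : rel V) (v : V) : {set V} :=
  [set u | e v u].

Definition is_2RDF (V : finType) (e : rel V) (f : {ffun V -> {set 'I_2}}) :
    bool :=
  [forall v, (f v == set0) ==>
     (\bigcup_(u in open_nbhd e v) f u == [set: 'I_2])].

Definition weight (V : finType) (f : {ffun V -> {set 'I_2}}) : nat :=
  \sum_(v : V) #|f v|.

(* The constant function with value {1,2} is always a 2RDF, so the arg min
   is never over an empty set. *)
Definition gamma_r2 (V : finType) (e : rel V) : nat :=
  weight [arg min_(f < [ffun=> [set: 'I_2]] | is_2RDF e f) weight f].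

(* ordS is the successor modulo n; this is the cycle C_n for n >= 3. *)
Definition cycle_graph (n : nat) : rel 'I_n :=
  [rel i j | (j == ordS i) || (i == ordS j)].

Definition box_prod (V W : finType) (e : rel V) (e' : rel W) : rel (V * W) :=
  [rel x y | (x.1 == y.1) && e' x.2 y.2 || (x.2 == y.2) && e x.1 y.1].

Lemma is_2RDF_setT (V : finType) (e : rel V) :
  is_2RDF e [ffun=> [set: 'I_2]].
Proof.
apply/forallP => v; rewrite ffunE; apply/implyP => /eqP/setP/(_ ord0).
by rewrite !inE.
Qed.

Lemma gamma_r2_min (V : finType) (e : rel V) :
  (exists2 f, is_2RDF e f & weight f = gamma_r2 e) /\
  (forall f, is_2RDF e f -> gamma_r2 e <= weight f).
Proof.
rewrite /gamma_r2; case: arg_minnP => [|f fP fmin]; first exact: is_2RDF_setT.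
by split=> //; exists f.
Qed.

Lemma cycle_graph_sym (n : nat) : symmetric (@cycle_graph n).
Proof. by move=> i j; rewrite /cycle_graph /= orbC. Qed.

Lemma cycle_graph_irrefl (n : nat) : 1 < n -> irreflexive (@cycle_graph n).
Proof.
move=> n_gt1 i; rewrite /cycle_graph /= orbb; apply/negbTE/eqP => /(congr1 val) /= i_eq.
have [lt_Si | ] := ltnP i.+1 n.
  by move: i_eq; rewrite modn_small // => /n_Sn.
move=> le_nSi; have n_eq : i.+1 = n by apply/eqP; rewrite eqn_leq ltn_ord.
by move: n_gt1; rewrite -[X in 1 < X]n_eq i_eq n_eq modnn.
Qed.

Lemma box_prod_sym (V W : finType) (e : rel V) (e' : rel W) :
  symmetric e -> symmetric e' -> symmetric (box_prod e e').
Proof.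
move=> e_sym e'_sym x y.
by rewrite /box_prod /= e_sym e'_sym [y.1 == _]eq_sym [y.2 == _]eq_sym.
Qed.

Lemma box_prod_irrefl (V W : finType) (e : rel V) (e' : rel W) :
  irreflexive e -> irreflexive e' -> irreflexive (box_prod e e').
Proof. by move=> e_irr e'_irr x; rewrite /box_prod /= e_irr e'_irr !andbF. Qed.

(* Main.v *)
(** Lower bound: let [w j] be the weight of the [j]-th copy of [C_m].  Every
    vertex [v] satisfies [2 <= 2 |f v| + \sum_(u ~ v) |f u|], and summing over
    one copy gives [2 m <= 4 (w j) + w (j + 1) + w (j - 1)].  A copy whose
    weight lies below the claimed average [c] therefore has neighbouring copies
    whose excess over [c] adds up to at least twice its deficit, so letting
    each copy give half of its excess to either side bounds the average of [w]
    below by [c].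

    Upper bound: on [C_3k [] C_6l], colouring [(i, j)] with [j mod 2] when
    [3 %| i + j] is a 2RDF.  Contracting edges never increases the 2-rainbow
    domination number, and [C_m] is a contraction of [C_3k] for [m <= 3k]. *)

Require Import Defs.
From mathcomp Require Import all_boot all_order all_algebra.
From mathcomp Require Import zify ring lra.
Import Order.TTheory GRing.Theory Num.Theory.
Local Open Scope ring_scope.

(** * Monotonicity of 2-rainbow domination under contraction *)

Section Contraction.
Local Open Scope nat_scope.
Set Implicit Arguments.
Unset Strict Implicit.

(** Taking unions of colours over the fibres of [p] cannot increase weight. If [w] gets no colour,
    its whole fibre is uncoloured, so the neighbours that dominate a vertex of the fibre lie outside
    it and map to neighbours of [w]. *)
Lemma gamma_r2_contraction (V W : finType) (e : rel V) (e' : rel W)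
    (p : V -> W) :
  (forall w, exists v, p v = w) ->
  (forall u v, e u v -> (p u == p v) || e' (p u) (p v)) ->
  gamma_r2 e' <= gamma_r2 e.
Proof.
move=> p_surj p_edge.
have [[f /forallP f_dom <-] _] := gamma_r2_min e.
pose g : {ffun W -> {set 'I_2}} := [ffun w => \bigcup_(v | p v == w) f v].
have sub_g v c : c \in f v -> c \in g (p v).
  by move=> cfv; rewrite ffunE; apply/bigcupP; exists v.
have g_dom : is_2RDF e' g.
  apply/forallP => w; apply/implyP => /eqP gw0.
  have [v pvw] := p_surj w.
  have fv0 : f v == set0.
    by apply/set0Pn => -[c /sub_g]; rewrite pvw gw0 inE.
  have /eqP/setP f_cover := implyP (f_dom v) fv0.
  apply/eqP/setP => c; have := f_cover c; rewrite !inE => /bigcupP[u].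
  rewrite inE => evu /sub_g cgu; apply/bigcupP; exists (p u) => //.
  rewrite inE -pvw; case/orP: (p_edge _ _ evu) => // /eqP pvu.
  by move: cgu; rewrite -pvu pvw gw0 inE.
apply: leq_trans ((gamma_r2_min e').2 g g_dom) _.
rewrite /weight (partition_big p predT) //=; apply: leq_sum => w _.
rewrite ffunE; elim/big_rec2: _ => [|v s A _ le_As]; first by rewrite cards0.
by rewrite (leq_trans (leq_card_setU _ _)) ?leq_add2l.
Qed.

Lemma gamma_r2_box_cycle_le (W : finType) (e : rel W) (m M : nat) :
  0 < m <= M ->
  gamma_r2 (box_prod (@cycle_graph m) e)
    <= gamma_r2 (box_prod (@cycle_graph M) e).
Proof.
case: m => // m /= lt_mM.
(* The short cycle now has [m.+1] vertices; all vertices of the long one from [m] on collapse to its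
   last vertex. *)
pose p (i : 'I_M) : 'I_m.+1 := inord (minn i m).
have pE i : p i = minn i m :> nat by rewrite inordK // ltnS geq_minr.
have p_S (i : 'I_M) : (p i == p (ordS i)) || (p (ordS i) == ordS (p i)).
  rewrite -!val_eqE /= !pE /=; have := ltn_ord i.
  rewrite leq_eqVlt => /predU1P[iM | lt_iM]; last first.
    rewrite (modn_small lt_iM).
    have [le_mi | lt_im] := leqP m i.
      by apply/orP; left; apply/eqP; lia.
    by rewrite modn_small; [apply/orP; right; apply/eqP; lia | lia].
  (* Here [i] is the last vertex of the long cycle: its closing edge maps to the closing edge of the
     short one. *)
  have -> : minn i m = m by lia.
  by rewrite iM !modnn min0n eqxx orbT.
apply: (@gamma_r2_contraction _ _ _ _ (fun x : 'I_M * W => (p x.1, x.2))).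
  move=> [i a]; exists (widen_ord lt_mM i, a) => /=; congr pair.
  by apply/ord_inj; rewrite pE /=; have := ltn_ord i; lia.
move=> [i a] [j b]; rewrite /box_prod /= -pair_eqE /=.
case/orP=> /andP[/eqP-> edge]; first by rewrite eqxx edge orbT.
rewrite /pair_eq /= eqxx andbT; case/orP: edge => /eqP->; rewrite /cycle_graph /=.
  by case/orP: (p_S i) => ->; rewrite ?orbT.
by rewrite [p _ == p j]eq_sym; case/orP: (p_S j) => ->; rewrite ?orbT.
Qed.

End Contraction.

(** * Layer weights and cyclic averaging *)

Section LowerBound.
Local Open Scope nat_scope.
Set Implicit Arguments.
Unset Strict Implicit.

Lemma sum_ordS (n : nat) (F : 'I_n -> nat) : \sum_(i < n) F (ordS i) = \sum_(i < n) F i.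
Proof. by rewrite [RHS](reindex_inj (@ordS_inj n)). Qed.

Lemma sum_ord_pred (n : nat) (F : 'I_n -> nat) :
  \sum_(i < n) F (ord_pred i) = \sum_(i < n) F i.
Proof. by rewrite [RHS](reindex_inj (@ord_pred_inj n)). Qed.

(** The slack 2 is absorbed by integrality: a deficit [t >= 1] at [j] forces a combined neighbouring
    excess of at least [4 * t - 2 >= 2 * t]. *)
Lemma cyclic_average_ge (n c : nat) (w : 'I_n -> nat) :
  (forall j, 6 * c <= 4 * w j + w (ordS j) + w (ord_pred j) + 2) ->
  c * n <= \sum_j w j.
Proof.
move=> w_ge.
have deficit_le : \sum_j 2 * (c - w j)
    <= \sum_j ((w (ordS j) - c) + (w (ord_pred j) - c)).
  by apply: leq_sum => j _; have := w_ge j; lia.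
rewrite [X in _ <= X]big_split /= [X in _ <= X + _](sum_ordS (fun j => w j - c)) in deficit_le.
rewrite [X in _ <= _ + X](sum_ord_pred (fun j => w j - c)) -big_distrr /= in deficit_le.
(* With truncated subtraction both summands equal the maximum of [w j] and [c]. *)
have : \sum_j (w j + (c - w j)) = \sum_j (c + (w j - c)).
  by apply: eq_bigr => j _; lia.
by rewrite !big_split /= sum_nat_const card_ord; lia.
Qed.

Lemma torus_vertex_ge (m n : nat) (f : {ffun 'I_m * 'I_n -> {set 'I_2}})
    (i : 'I_m) (j : 'I_n) :
  is_2RDF (box_prod (@cycle_graph m) (@cycle_graph n)) f ->
  2 <= 2 * #|f (i, j)| + (#|f (ordS i, j)| + #|f (ord_pred i, j)|)
       + (#|f (i, ordS j)| + #|f (i, ord_pred j)|).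
Proof.
move=> /forallP/(_ (i, j))/implyP.
have [f0 /(_ isT)/eqP f_cover | fn0 _] := eqVneq (f (i, j)) set0; last first.
  by have : 0 < #|f (i, j)| by [rewrite card_gt0]; lia.
rewrite f0 cards0 muln0 add0n.
rewrite -[leqLHS](card_ord 2) -cardsT.
apply: (leq_trans (n := #|(f (ordS i, j) :|: f (ord_pred i, j))
                   :|: (f (i, ordS j) :|: f (i, ord_pred j))|)); last first.
  apply: leq_trans (leq_card_setU _ _) _.
  by apply: leq_add; apply: leq_card_setU.
rewrite -f_cover; apply/subset_leq_card/bigcupsP => -[i' j'].
rewrite inE /box_prod /=.
case/orP=> /andP[/eqP<- /orP[/eqP->|/eqP->]]; rewrite ?ordSK;
  by apply/subsetP => c c_in; rewrite !inE c_in ?orbT.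
Qed.

Lemma torus_layer_ge (m n : nat) (f : {ffun 'I_m * 'I_n -> {set 'I_2}})
    (w := fun j : 'I_n => \sum_(i < m) #|f (i, j)|) (j : 'I_n) :
  is_2RDF (box_prod (@cycle_graph m) (@cycle_graph n)) f ->
  2 * m <= 4 * w j + w (ordS j) + w (ord_pred j).
Proof.
move=> f_dom.
have : \sum_(i < m) 2 <= _ := leq_sum _ (fun i _ => torus_vertex_ge i j f_dom).
rewrite sum_nat_const card_ord !big_split /=.
rewrite [X in _ + (X + _) + _](sum_ordS (fun i => #|f (i, j)|)).
rewrite [X in _ + (_ + X) + _](sum_ord_pred (fun i => #|f (i, j)|)).
by rewrite big1_eq -!/(w _); lia.
Qed.

Lemma weight_layers (m n : nat) (f : {ffun 'I_m * 'I_n -> {set 'I_2}}) :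
  weight f = \sum_j \sum_(i < m) #|f (i, j)|.
Proof.
rewrite /weight exchange_big pair_big /=.
by apply: eq_bigr => -[].
Qed.

(* The scaling factor [d] makes room for half-integral averages. *)
Lemma gamma_r2_torus_ge (m n c d : nat) :
  6 * c <= d * (2 * m) + 2 ->
  c * n <= d * gamma_r2 (box_prod (@cycle_graph m) (@cycle_graph n)).
Proof.
move=> c_le; have [[f f_dom <-] _] :=
  gamma_r2_min (box_prod (@cycle_graph m) (@cycle_graph n)).
(* The averaging is applied to the layer weights multiplied by [d]; the slack 2 stays unscaled. *)
rewrite weight_layers big_distrr /=; apply: cyclic_average_ge => j.
apply: leq_trans c_le _; rewrite leq_add2r.
apply: leq_trans (leq_mul (leqnn d) (torus_layer_ge j f_dom)) _.
by rewrite 2!mulnDr mulnCA.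
Qed.

End LowerBound.

(** * The diagonal colouring of the torus *)

Section UpperBound.
Local Open Scope nat_scope.
Set Implicit Arguments.
Unset Strict Implicit.

Lemma modn_ordS (d n : nat) (i : 'I_n) : d %| n -> ordS i = i.+1 %[mod d].
Proof. by move=> d_n; rewrite /= modn_dvdm. Qed.

Lemma modn_ord_pred (d n : nat) (i : 'I_n) :
  d %| n -> (ord_pred i).+1 = i %[mod d].
Proof. by move=> d_n; rewrite -(modn_ordS _ d_n) ord_predK. Qed.

Lemma sum_dvd3 (k j : nat) : \sum_(i < 3 * k) (3 %| i + j) = k.
Proof.
rewrite -(big_mkord predT (fun i => nat_of_bool (3 %| i + j))) /=.
elim: k => [|k IHk]; first by rewrite muln0 big_geq.
have -> : 3 * k.+1 = (3 * k).+3 by lia.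
by rewrite !big_nat_recr //= IHk; lia.
Qed.

Definition torus_pattern (m n : nat) : {ffun 'I_m * 'I_n -> {set 'I_2}} :=
  [ffun x : 'I_m * 'I_n => [set c : 'I_2 | (3 %| x.1 + x.2) && (x.2 %% 2 == c)]].

Lemma mem_torus_pattern (m n : nat) (i : 'I_m) (j : 'I_n) (c : 'I_2) :
  (c \in torus_pattern m n (i, j)) = (3 %| i + j) && (j %% 2 == c).
Proof. by rewrite ffunE inE. Qed.

Lemma weight_torus_pattern (k n : nat) :
  weight (torus_pattern (3 * k) n) = k * n.
Proof.
rewrite weight_layers.
under eq_bigr => j _.
  under eq_bigr => i _.
    have -> : #|torus_pattern (3 * k) n (i, j)| = (3 %| i + j).
      have [ij3 | ij3] := boolP (3 %| i + j); last first.
        by apply: eq_card0 => c; rewrite mem_torus_pattern (negbTE ij3).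
      apply: (eq_card1 (x := inord (j %% 2))) => c.
      by rewrite mem_torus_pattern ij3 inE eq_sym -val_eqE /= inordK ?ltn_pmod.
    over.
  rewrite sum_dvd3; over.
by rewrite sum_nat_const card_ord mulnC.
Qed.

(** The divisibility conditions keep residues mod 3, and the parity of [j], consistent across the
    closing edges. *)
Lemma torus_pattern_2RDF (m n : nat) : 3 %| m -> 6 %| n ->
  is_2RDF (box_prod (@cycle_graph m) (@cycle_graph n)) (torus_pattern m n).
Proof.
move=> m3 n6; have n3 : 3 %| n := dvdn_trans (isT : 3 %| 6) n6.
have n2 : 2 %| n := dvdn_trans (isT : 2 %| 6) n6.
apply/forallP => -[i j]; apply/implyP => /eqP/setP empty.
have ij_n0 : ~~ (3 %| i + j).
  apply/negP => ij3; have := empty (inord (j %% 2)).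
  by rewrite mem_torus_pattern inE inordK ?ltn_pmod // ij3 eqxx.
apply/eqP/setP => c; rewrite inE; apply/bigcupP.
have c_lt2 := ltn_ord c.
have Si := modn_ordS i m3; have Pi := modn_ord_pred i m3.
have Sj := modn_ordS j n3; have Pj := modn_ord_pred j n3.
have Sj2 := modn_ordS j n2; have Pj2 := modn_ord_pred j n2.
(* The colour of the parity of [j] comes from a neighbour in the same layer, the other colour from
   an adjacent layer. Residue 1 calls for predecessors, residue 2 for successors. *)
have [c_j | c_j] := eqVneq (j %% 2) c; have [ij1 | ij1] := eqVneq ((i + j) %% 3) 1.
- exists (ord_pred i, j); first by rewrite inE /box_prod /cycle_graph /= ord_predK !eqxx !orbT.
  by rewrite mem_torus_pattern; apply/andP; split; [move: Pi | exact/eqP]; lia.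
- exists (ordS i, j); first by rewrite inE /box_prod /cycle_graph /= !eqxx !orbT.
  by rewrite mem_torus_pattern; apply/andP; split; [move: Si | exact/eqP]; lia.
- exists (i, ord_pred j); first by rewrite inE /box_prod /cycle_graph /= ord_predK !eqxx !orbT.
  by rewrite mem_torus_pattern; apply/andP; split; [move: Pj | move: Pj2]; lia.
exists (i, ordS j); first by rewrite inE /box_prod /cycle_graph /= !eqxx.
by rewrite mem_torus_pattern; apply/andP; split; [move: Sj | move: Sj2]; lia.
Qed.

Lemma gamma_r2_torus_le (k m n : nat) : 0 < m <= 3 * k -> 6 %| n ->
  gamma_r2 (box_prod (@cycle_graph m) (@cycle_graph n)) <= k * n.
Proof.
move=> m_le n6.
apply: leq_trans (gamma_r2_box_cycle_le (@cycle_graph n) m_le) _.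
rewrite -(weight_torus_pattern k n); apply: (gamma_r2_min _).2.
by apply: torus_pattern_2RDF; rewrite ?dvdn_mulr.
Qed.

End UpperBound.

Theorem theorem1 (m n : nat) (m_ge3 : (3 <= m)%N) (n_ge6 : (6 <= n)%N)
    (n_mod6 : (n = 0 %[mod 6])%N) :
  [/\ (m = 0 %[mod 3])%N ->
        (gamma_r2 (box_prod (@cycle_graph m) (@cycle_graph n)))%:R
          = m%:R / 3 * n%:R :> rat,
      (m = 1 %[mod 3])%N ->
        ((m%:R - 1) / 3 + 1 / 2) * n%:R
          <= (gamma_r2 (box_prod (@cycle_graph m) (@cycle_graph n)))%:R :> rat
        /\ (gamma_r2 (box_prod (@cycle_graph m) (@cycle_graph n)))%:R
          <= (m%:R + 2) / 3 * n%:R :> rat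
    & (m = 2 %[mod 3])%N ->
        (gamma_r2 (box_prod (@cycle_graph m) (@cycle_graph n)))%:R
          = (m%:R + 1) / 3 * n%:R :> rat].
Proof.
have n6 : (6 %| n)%N by rewrite /dvdn n_mod6.
have upper k := @gamma_r2_torus_le k m n.
have lower := @gamma_r2_torus_ge m n.
move: (gamma_r2 _) upper lower => g upper lower.
(* Thanks to the slack 2, the lower bound reaches [k * n] even when [m] is [3 * k - 1], which
   settles residues 0 and 2 together. *)
have exact_value k : (3 * k <= m.+1)%N -> (m <= 3 * k)%N -> g = (k * n)%N.
  move=> k_le k_ge; apply/eqP; rewrite eqn_leq upper ?(leq_trans _ m_ge3) //=.
  by have := lower k 1%N; rewrite !mul1n; apply; lia.
have [k m_div] : exists k, m = (k * 3 + m %% 3)%N.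
  by exists (m %/ 3)%N; apply: divn_eq.
split=> m_mod; rewrite m_mod in m_div.
- have m_eq : m = (k * 3)%N by lia.
  by rewrite (exact_value k) ?m_eq ?natrM; [field | lia | lia].
- have m_eq : m = (k * 3 + 1)%N by lia.
  have g_le : (g <= k.+1 * n)%N by apply: upper; lia.
  (* Doubling turns the average [k + 1 / 2] into an integer; the required inequality is then the
     equality [6 * (2 * k + 1) = 2 * (2 * m) + 2]. *)
  have g_ge : ((2 * k).+1 * n <= 2 * g)%N by apply: lower; lia.
  rewrite -(ler_nat rat) natrM -natr1 in g_le.
  rewrite -(ler_nat rat) !natrM -natr1 natrM in g_ge.
  have -> : m%:R = k%:R * 3 + 1 :> rat by rewrite m_eq natrD natrM.
  have -> : (k%:R * 3 + 1 - 1) / 3 + 1 / 2 = (2 * k%:R + 1) / 2 :> rat by field.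
  have -> : (k%:R * 3 + 1 + 2) / 3 = k%:R + 1 :> rat by field.
  split; lra.
have m_eq : m = (k * 3 + 2)%N by lia.
rewrite (exact_value k.+1); [|lia|lia].
by rewrite m_eq natrD !natrM -natr1; field.
Qed.
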